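(* Let $\mathcal{S}=\{S_d:\mathcal{H}_d\to\mathcal{G}_d\}_{d\in\mathbb{N}}$ be a sequence of compact linear operators between Hilbert spaces, with eigenvalues $\lambda_{d,1}\ge\lambda_{d,2}\ge\cdots\ge 0$ of $S_d^*S_d$. Fix an error criterion, ABS or NOR, and let $\mathrm{CRI}_d=1$ for ABS and $\mathrm{CRI}_d=\lambda_{d,1}$ for NOR. Then, for the chosen criterion: (i) $\mathcal{S}$ is ALG-UWT-ABS/NOR iff $$\lim_{n\to\infty}\ \inf_{d\in\mathbb{N}:\ d\le(\ln n)^k}\ \frac{\ln\frac{\mathrm{CRI}_d}{\lambda_{d,n}}}{\ln\ln n}=\infty\qquad\text{for all }k\in\mathbb{N}.$$ (ii) $\mathcal{S}$ is EXP-UWT-ABS/NOR iff $$\lim_{n\to\infty}\ \inf_{d\in\mathbb{N}:\ d\le(\ln n)^k}\ \frac{\ln\left(\max\left(1,\ln\frac{\mathrm{CRI}_d}{\lambda_{d,n}}\right)\right)}{\ln\ln n}=\infty\qquad\text{for all }k\in\mathbb{N}.$$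
   Context: Setting. $\mathbb{N}=\{1,2,\dots\}$, $\mathbb{N}_0=\mathbb{N}\cup\{0\}$. For each $d\in\mathbb{N}$, $\mathcal{H}_d$ and $\mathcal{G}_d$ are Hilbert spaces and $S_d:\mathcal{H}_d\to\mathcal{G}_d$ is a compact linear operator; $\mathcal{S}=\{S_d\}_{d\in\mathbb{N}}$. The operator $W_d=S_d^*S_d$ is compact, self-adjoint and positive semi-definite; $\lambda_{d,1}\ge\lambda_{d,2}\ge\cdots$ denote its eigenvalues in non-increasing order, counted with multiplicity (the positive ones are listed; if there are only finitely many, the sequence is continued by zeros). For the criterion NOR it is assumed that $S_d\neq0$, i.e. $\lambda_{d,1}=\|S_d\|^2>0$. Convention: if $\lambda_{d,n}=0$, then $\mathrm{CRI}_d/\lambda_{d,n}=\infty$ and $\ln\infty=\infty$. In the limits $n\to\infty$ only $n\ge3$ need be considered, so that $\ln\ln n>0$ and the set of admissible $d$ is non-empty. Information complexity. An algorithm $A_{d,n}:\mathcal{H}_d\to\mathcal{G}_d$ has $A_{d,0}=0$, and for $n\ge1$ has the form $A_{d,n}(f)=\phi_n(L_1(f),\dots,L_n(f))$ with an arbitrary map $\phi_n:\mathbb{C}^n\to\mathcal{G}_d$ and continuous linear functionals $L_j$ on $\mathcal{H}_d$, possibly chosen adaptively ($L_j$ may depend on $L_1(f),\dots,L_{j-1}(f)$). Its worst case error is $e(A_{d,n})=\sup_{\|f\|_{\mathcal{H}_d}\le1}\|S_d(f)-A_{d,n}(f)\|_{\mathcal{G}_d}$, and $e(n,S_d)=\inf_{A_{d,n}}e(A_{d,n})$.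 For $\varepsilon>0$, $n_{\mathrm{ABS}}(\varepsilon,S_d)=\min\{n\in\mathbb{N}_0: e(n,S_d)\le\varepsilon\}$ (absolute error criterion, ABS) and $n_{\mathrm{NOR}}(\varepsilon,S_d)=\min\{n\in\mathbb{N}_0: e(n,S_d)\le\varepsilon\|S_d\|\}$ (normalized error criterion, NOR). It is a known fact that $n_{\mathrm{ABS}}(\varepsilon,S_d)=\min\{n\in\mathbb{N}_0:\lambda_{d,n+1}\le\varepsilon^2\}$ and $n_{\mathrm{NOR}}(\varepsilon,S_d)=\min\{n\in\mathbb{N}_0:\lambda_{d,n+1}\le\varepsilon^2\lambda_{d,1}\}$; these formulas may be taken as the definition. Tractability notions (for ABS or NOR). For $s,t>0$, $\mathcal{S}$ is ALG-$(s,t)$-WT-ABS/NOR iff $$\lim_{d+\varepsilon^{-1}\to\infty}\frac{\ln\max(1,n_{\mathrm{ABS}/\mathrm{NOR}}(\varepsilon,S_d))}{d^{t}+(\max(1,\varepsilon^{-1}))^{s}}=0,$$ and $\mathcal{S}$ is EXP-$(s,t)$-WT-ABS/NOR iff $$\lim_{d+\varepsilon^{-1}\to\infty}\frac{\ln\max(1,n_{\mathrm{ABS}/\mathrm{NOR}}(\varepsilon,S_d))}{d^{t}+(1+\ln\max(1,\varepsilon^{-1}))^{s}}=0,$$ where the limit means: for every $\delta>0$ there is $K$ such that the quotient is at most $\delta$ for all $d\in\mathbb{N}$ and $\varepsilon>0$ with $d+\varepsilon^{-1}\ge K$. $\mathcal{S}$ is ALG-UWT-ABS/NOR (uniformly weakly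 tractable, algebraic case) iff it is ALG-$(s,t)$-WT-ABS/NOR for all $s,t>0$; $\mathcal{S}$ is EXP-UWT-ABS/NOR (uniformly weakly tractable, exponential case) iff it is EXP-$(s,t)$-WT-ABS/NOR for all $s,t>0$. *)

(* Defs.v *)
From HB Require Import structures.
From mathcomp Require Import all_boot all_order all_algebra.
From mathcomp Require Import all_classical all_reals all_analysis.
From mathcomp Require Import complex.

Set Implicit Arguments.
Unset Strict Implicit.
Unset Printing Implicit Defensive.

Import Order.TTheory GRing.Theory Num.Theory.
Import numFieldNormedType.Exports.

Local Open Scope classical_set_scope.
Local Open Scope ring_scope.

Record hilbertType (R : realType) := Hilbert {
  hilbert_sort :> completeNormedModType R[i];
  dotp : {dot hilbert_sort for (@Num.conj R[i])};
  dotp_norm : forall x : hilbert_sort, dotp x x = `|x| ^+ 2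
}.

Section Operators.
Context {R : realType}.

Definition compact_operator (H G : hilbertType R) (S : H -> G) : Prop :=
  precompact (S @` [set f : H | `|f| <= 1]).

(* T is the (unique) adjoint of S *)
Definition is_adjoint (H G : hilbertType R) (S : H -> G) (T : G -> H) : Prop :=
  forall (f : H) (g : G), dotp G (S f) g = dotp H f (T g).

Definition op_eigenspace (V : lmodType R[i]) (W : V -> V) (mu : R[i]) : set V :=
  [set f | W f = mu *: f].

Definition has_dim (V : lmodType R[i]) (E : set V) (m : nat) : Prop :=
  exists e : 'I_m -> V,
    (forall c : 'I_m -> R[i], \sum_i c i *: e i = 0 -> forall i, c i = 0) /\
    E = [set f | exists c : 'I_m -> R[i], f = \sum_i c i *: e i].

(* lam 1 >= lam 2 >= ... lists the positive eigenvalues of W with multiplicity,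
   continued by zeros when there are finitely many; lam 0 is not used.
   For mu > 0 the value mu occurs exactly dim ker (W - mu) times; together with
   monotonicity and nonnegativity this determines (lam n)_{n >= 1}. *)
Definition eigenvalue_sequence (V : lmodType R[i]) (W : V -> V)
    (lam : nat -> R) : Prop :=
  [/\ forall n, (0 < n)%N -> 0 <= lam n,
      forall m n, (0 < m)%N -> (m <= n)%N -> lam n <= lam m &
      forall mu : R, 0 < mu -> exists2 m : nat,
        has_dim (op_eigenspace W (mu%:C)%C) m &
        ([set n | (0 < n)%N /\ lam n = mu] #= `I_m)%card].

End Operators.

Variant criterion := ABS | NOR.

Section Tractability.
Context {R : realType}.

Definition CRI (cri : criterion) (lam : nat -> R) : R :=
  match cri with ABS => 1 | NOR => lam 1%N end.

(* min {n in N_0 | lam_{n+1} <= eps^2 CRI}. For the eigenvalues of a compact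
   operator this set is nonempty (they tend to 0), so that the default value
   0 of xget is irrelevant. *)
Definition info_complexity (cri : criterion) (lam : nat -> R) (eps : R) : nat :=
  let P := [set n : nat | lam n.+1 <= eps ^+ 2 * CRI cri lam] in
  xget 0%N [set n | P n /\ forall m, P m -> (n <= m)%N].

(* In the following, lam d is the eigenvalue sequence of the d-th operator;
   the index d ranges over the positive integers. *)

Definition ALG_WT (cri : criterion) (lam : nat -> nat -> R) (s t : R) : Prop :=
  forall delta : R, 0 < delta -> exists K : R, forall (d : nat) (eps : R),
    (0 < d)%N -> 0 < eps -> K <= d%:R + eps^-1 ->
    ln (maxn 1 (info_complexity cri (lam d) eps))%:R
      / (d%:R `^ t + (Num.max 1 eps^-1) `^ s) <= delta.

Definition EXP_WT (cri : criterion) (lam : nat -> nat -> R) (s t : R) : Prop :=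
  forall delta : R, 0 < delta -> exists K : R, forall (d : nat) (eps : R),
    (0 < d)%N -> 0 < eps -> K <= d%:R + eps^-1 ->
    ln (maxn 1 (info_complexity cri (lam d) eps))%:R
      / (d%:R `^ t + (1 + ln (Num.max 1 eps^-1)) `^ s) <= delta.

Definition ALG_UWT (cri : criterion) (lam : nat -> nat -> R) : Prop :=
  forall s t : R, 0 < s -> 0 < t -> ALG_WT cri lam s t.

Definition EXP_UWT (cri : criterion) (lam : nat -> nat -> R) : Prop :=
  forall s t : R, 0 < s -> 0 < t -> EXP_WT cri lam s t.

(* ln (CRI_d / lam_{d,n}), equal to +oo when lam_{d,n} = 0 < CRI_d, since the
   extended inverse of 0 is +oo and lne +oo = +oo *)
Definition ln_ratio (cri : criterion) (lam : nat -> R) (n : nat) : \bar R :=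
  lne ((CRI cri lam)%:E / (lam n)%:E)%E.

Definition admissible (n k : nat) : set nat :=
  [set d | (0 < d)%N /\ d%:R <= (ln n%:R : R) ^+ k].

End Tractability.

Arguments admissible R n k : clear implicits.

(* Main.v *)
Require Import Defs.
From HB Require Import structures.
From mathcomp Require Import all_boot all_order all_algebra.
From mathcomp Require Import all_classical all_reals all_analysis.
From mathcomp Require Import complex.
From mathcomp Require Import lra.

(* Compactness enters twice. Normalized eigenvectors of [S^* S] for distinct
   eigenvalues [>= c > 0] have images under [S] that are at distance at least
   [sqrt (2 c)], so the eigenvalues tend to [0] and the information complexity
   is a true minimum; and a vector of maximal norm in the closure of the image
   of the unit ball provides a positive eigenvalue when [S <> 0], so
   [CRI_d > 0].
   The rest compares rates. Let [w eps] be [max 1 eps^-1] (algebraic case) or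
   [1 + ln (max 1 eps^-1)] (exponential case) and [E] its inverse on [1, +oo[.
   Both the tractability notion and the limit condition are equivalent to: for
   all [k] and [B], for large [n], [lam_{d,n} <= E((ln n)^B)^2 CRI_d] whenever
   [d <= (ln n)^k]. From tractability one takes [eps = E((ln n)^B)], [s = 1/B],
   [t = 1/k]; conversely, if [N] is the information complexity, then
   [lam_{d,N} > eps^2 CRI_d], so that either [d > (ln N)^k] or
   [w eps >= (ln N)^B], and with [k t >= 2], [B s >= 2] the denominator is at
   least [(ln N)^2]. *)

Set Implicit Arguments.
Unset Strict Implicit.
Unset Printing Implicit Defensive.

Import Order.TTheory GRing.Theory Num.Theory.
Import numFieldNormedType.Exports.

Local Open Scope classical_set_scope.
Local Open Scope ring_scope.

(** * The real part of the inner product: bilinearity, Cauchy-Schwarz, continuity of the norm *)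

Section RealInnerProduct.
Variables (R : realType) (H : hilbertType R).
Implicit Types (x y z : H) (a : R).

Definition rdot x y : R := complex.Re (dotp H x y).
Definition rnorm x : R := complex.Re `|x|.

Lemma rnormE x : (rnorm x)%:C%C = `|x|.
Proof. by rewrite RRe_real// normr_real. Qed.

Lemma rnorm_ge0 x : 0 <= rnorm x.
Proof. by rewrite -ler0c rnormE normr_ge0. Qed.

Lemma rnorm_eq0 x : rnorm x = 0 -> x = 0.
Proof. by move=> x0; apply/eqP; rewrite -normr_eq0 -rnormE x0. Qed.

Lemma rnorm0 : rnorm 0 = 0.
Proof. by rewrite /rnorm normr0. Qed.

Lemma rnorm_gt0 x : x != 0 -> 0 < rnorm x.
Proof.
move=> x0; rewrite lt_neqAle rnorm_ge0 andbT eq_sym.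
by apply: contra x0 => /eqP/rnorm_eq0 ->.
Qed.

Lemma rnormZ a x : 0 <= a -> rnorm (a%:C%C *: x) = a * rnorm x.
Proof.
move=> a0; rewrite /rnorm normrZ -rnormE normc_def/= expr0n addr0 sqrtr_sqr.
by rewrite ger0_norm//= mul0r subr0.
Qed.

Lemma le1_rnorm x : (`|x| <= 1) = (rnorm x <= 1).
Proof. by rewrite -rnormE -[1 in LHS]/(1%:C%C) lecR. Qed.

Lemma ler_dist_rnorm x y : `|rnorm x - rnorm y| <= rnorm (x - y).
Proof.
rewrite -lecR rnormE.
apply: le_trans (ler_dist_dist x y).
by rewrite -!rnormE -rmorphB normc_def/= expr0n addr0 sqrtr_sqr.
Qed.

Lemma rdotC x y : rdot x y = rdot y x.
Proof. by rewrite /rdot hermC/= expr0 mul1r; case: (dotp H y x). Qed.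

Lemma rdotBl x y z : rdot (x - y) z = rdot x z - rdot y z.
Proof.
by rewrite /rdot linearBl/=; case: (dotp H x z) (dotp H y z) => ? ? [].
Qed.

Lemma rdotZl a x y : rdot (a%:C%C *: x) y = a * rdot x y.
Proof.
rewrite /rdot linearZl_LR/=; case: (dotp H x y) => u v /=.
by rewrite mul0r subr0.
Qed.

Lemma rdotBr x y z : rdot z (x - y) = rdot z x - rdot z y.
Proof. by rewrite rdotC rdotBl !(rdotC z). Qed.

Lemma rdotZr a x y : rdot y (a%:C%C *: x) = a * rdot y x.
Proof. by rewrite rdotC rdotZl (rdotC y). Qed.

Lemma rdotxx x : rdot x x = rnorm x ^+ 2.
Proof. by rewrite /rdot dotp_norm -rnormE -rmorphXn. Qed.

(** The squared norm of [|y| x - |x| y] equals [2 |x| |y| (|x| |y| - rdot x y)] and is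
    nonnegative. *)
Lemma rdot_le x y : rdot x y <= rnorm x * rnorm y.
Proof.
have [->|x0] := eqVneq x 0.
  by rewrite rnorm0 mul0r -(subrr 0) rdotBl subrr.
have [->|y0] := eqVneq y 0.
  by rewrite rnorm0 mulr0 -(subrr 0) rdotBr subrr.
have nx := rnorm_gt0 x0; have ny := rnorm_gt0 y0.
have : 0 <= rdot ((rnorm y)%:C%C *: x - (rnorm x)%:C%C *: y)
                 ((rnorm y)%:C%C *: x - (rnorm x)%:C%C *: y).
  by rewrite rdotxx sqr_ge0.
rewrite !(rdotBl, rdotBr, rdotZl, rdotZr) !rdotxx (rdotC y x).
set u := rnorm x in nx *; set v := rnorm y in ny *; set r := rdot x y => h.
suff : 0 <= (u * v) * (u * v - r) by rewrite pmulr_rge0 ?mulr_gt0// subr_ge0.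
lra.
Qed.

Lemma rnorm_continuous : continuous (rnorm : H -> R).
Proof.
move=> x; apply/cvgrPdist_lt => e e0.
have e0' : 0 < e%:C%C :> R[i] by rewrite ltcR.
near=> y; apply: le_lt_trans (ler_dist_rnorm _ _) _.
rewrite -ltcR rnormE; near: y.
exact: (@cvgr_dist_lt _ _ _ (nbhs x) _ id x).
Unshelve. all: by end_near. Qed.

End RealInnerProduct.

(** * Eigenvectors of [T S] for a compact [S] with adjoint [T] *)

Section CompactOperator.
Variables (R : realType) (H G : hilbertType R) (S : {linear H -> G}) (T : G -> H).
Hypotheses (S_compact : compact_operator S) (S_adjoint : is_adjoint S T).

Let image_ball : set G := S @` [set f : H | `|f| <= 1].

Let compact_closure : compact (closure image_ball).
Proof. by rewrite -precompactE. Qed.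

Lemma rdot_adjoint f g : rdot (S f) g = rdot f (T g).
Proof. by rewrite /rdot S_adjoint. Qed.

(** By the adjoint identity, the difference of the two sides has [rdot] zero with itself. *)
Lemma adjointZ a g : T (a%:C%C *: g) = a%:C%C *: T g.
Proof.
apply/eqP; rewrite -subr_eq0; apply/eqP/rnorm_eq0/eqP.
rewrite -sqrf_eq0 -rdotxx rdotBr rdotZr -!rdot_adjoint rdotZr.
by rewrite subrr.
Qed.

(** The norm attains its maximum on the compact closure of the image of the unit ball; the bound for
    general [f] follows by normalizing [f]. *)
Lemma norm_attained : exists2 g, closure image_ball g &
  forall f, rnorm (S f) <= rnorm g * rnorm f.
Proof.
have B0 : closure image_ball !=set0.
  exists 0; apply: subset_closure; exists 0; rewrite ?linear0//=.
  by rewrite normr0.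
have [g /set_mem gB gmax] := compact_EVT_max B0 compact_closure
  (continuous_subspaceT (@rnorm_continuous R G)).
exists g => // f; have [->|f0] := eqVneq f 0.
  by rewrite linear0 !rnorm0 mulr0.
have nf := rnorm_gt0 f0.
rewrite -ler_pdivrMr// mulrC -rnormZ ?invr_ge0 ?rnorm_ge0//.
rewrite -linearZ; apply/gmax/mem_set/subset_closure.
exists (((rnorm f)^-1)%:C%C *: f) => //=.
by rewrite le1_rnorm rnormZ ?invr_ge0 ?rnorm_ge0// mulVf// gt_eqF.
Qed.

(* A norm maximizer [g] in the closure of the image of the unit ball satisfies
   [S (T g) = |g|^2 g], by the equality case of the Cauchy-Schwarz inequality. *)
Lemma compact_top_eigenvector : (exists f, S f <> 0) ->
  exists2 mu : R, 0 < mu & exists2 h, h != 0 & T (S h) = mu%:C%C *: h.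
Proof.
move=> [f0 Sf0]; have [g gB gmax] := norm_attained.
set M := rnorm g in gmax.
have M0 : 0 < M.
  have := gmax f0; have /eqP/rnorm_gt0 := Sf0.
  move=> /lt_le_trans /[apply]; have := rnorm_ge0 f0; rewrite le_eqVlt.
  by move=> /predU1P[<-|f0p]; rewrite ?mulr0 ?ltxx// pmulr_lgt0.
have M20 : 0 < M ^+ 2 by rewrite exprn_gt0.
have leTg : rnorm (T g) <= M ^+ 2.
  have := rnorm_ge0 (T g); rewrite le_eqVlt => /predU1P[<-|t0]; first exact: ltW.
  have h : rnorm (T g) ^+ 2 <= M * rnorm (T g) * M.
    rewrite -rdotxx -rdot_adjoint (le_trans (rdot_le _ _))//.
    by rewrite ler_pM2r.
  rewrite -(ler_pM2r t0); lra.
(* Approximate [g] by [S f] with [|f| <= 1]: up to [e], [M^2 = rdot g g] is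
   [rdot (S f) g = rdot f (T g)], which is at most [|T g|]. *)
have geTg : M ^+ 2 <= rnorm (T g).
  apply/ler_addgt0Pr => e e0.
  have eM : 0 < (e / M)%:C%C :> R[i] by rewrite ltcR divr_gt0.
  have [_ [[f /= f1 <-] gf]] := gB _ (nbhsx_ballx g _ eM).
  have : rdot (g - S f) g <= e / M * M.
    apply: (le_trans (rdot_le _ _)); rewrite ler_pM2r//.
    by move: gf; rewrite -ball_normE/= -rnormE ltcR => /ltW.
  rewrite divfK ?gt_eqF// rdotBl rdotxx rdot_adjoint.
  have : rdot f (T g) <= rnorm (T g).
    rewrite (le_trans (rdot_le _ _))// ler_piMl ?rnorm_ge0//.
    by rewrite -le1_rnorm.
  rewrite -/M; lra.
have Tg : rnorm (T g) = M ^+ 2 by apply/eqP; rewrite eq_le leTg.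
have STg : S (T g) = (M ^+ 2)%:C%C *: g.
  apply/eqP; rewrite -subr_eq0; apply/eqP/rnorm_eq0/eqP.
  (* The squared norm of the difference is [|S (T g)|^2 - 2 M^6 + M^6], and maximality of [M] gives
     [|S (T g)|^2 <= M^6]. *)
  rewrite -sqrf_eq0 eq_le sqr_ge0 andbT.
  have e : rdot (S (T g)) g = (M ^+ 2) ^+ 2 by rewrite rdot_adjoint rdotxx Tg.
  rewrite -rdotxx !(rdotBl, rdotBr, rdotZl, rdotZr) (rdotC g (S _)) e.
  rewrite !rdotxx -/M.
  have : rnorm (S (T g)) ^+ 2 <= (M * M ^+ 2) ^+ 2.
    have le : rnorm (S (T g)) <= M * M ^+ 2 by rewrite -Tg; exact: gmax.
    by rewrite ler_sqr// nnegrE ?rnorm_ge0// mulr_ge0 ?ltW.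
  lra.
exists (M ^+ 2) => //; exists (T g); last by rewrite STg adjointZ.
by apply/eqP => Tg0; move: Tg; rewrite Tg0 rnorm0 => M2; rewrite -M2 ltxx in M20.
Qed.

(** Moving [S] across the product on either side gives both [mu * rdot f h] and [nu * rdot f h], so
    [rdot f h = 0]. *)
Lemma eigenvector_orthogonal (mu nu : R) f h : mu != nu ->
  T (S f) = mu%:C%C *: f -> T (S h) = nu%:C%C *: h -> rdot (S f) (S h) = 0.
Proof.
move=> munu ef eh.
have eqf : rdot (S f) (S h) = mu * rdot f h.
  by rewrite rdotC rdot_adjoint ef rdotZr rdotC.
have eqh : rdot (S f) (S h) = nu * rdot f h by rewrite rdot_adjoint eh rdotZr.
have /eqP := eqf; rewrite eqh eq_sym -subr_eq0 -mulrBl mulf_eq0 subr_eq0.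
by rewrite (negbTE munu)/= => /eqP ->; rewrite mulr0.
Qed.

(* The vectors [S (f i)] are orthogonal and of norm at least [sqrt c], hence
   they have no cluster point. *)
Lemma compact_eigenvalues_not_away0 (c : R) (mu : nat -> R) : 0 < c ->
  injective mu -> (forall i, c <= mu i) ->
  ~ forall i, exists2 f, f != 0 & T (S f) = (mu i)%:C%C *: f.
Proof.
move=> c0 muI cmu ev.
have /choice[f0 f0P] i : exists f, f != 0 /\ T (S f) = (mu i)%:C%C *: f.
  by have [f] := ev i; exists f.
pose f i := ((rnorm (f0 i))^-1)%:C%C *: f0 i.
have f1 i : rnorm (f i) = 1.
  have [/rnorm_gt0 n0 _] := f0P i.
  by rewrite rnormZ ?invr_ge0 ?rnorm_ge0// mulVf// gt_eqF.
have ef i : T (S (f i)) = (mu i)%:C%C *: f i.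
  have [_ e] := f0P i.
  by rewrite /f linearZ/= adjointZ e !scalerA mulrC.
have F1 : (S \o f @ \oo) (closure image_ball).
  exists 0%N => // i _; apply: subset_closure; exists (f i) => //=.
  by rewrite le1_rnorm f1.
have [p [_ pP]] := compact_closure (fmap_proper_filter (S \o f) _) F1.
(* Two points within [r] of [p] are less than [2 r = sqrt (2 c)] apart, whereas the orthogonal
   images are at least that far apart. *)
pose r := Num.sqrt (c / 2).
have r0 : 0 < r by rewrite sqrtr_gt0 divr_gt0.
have ballp : nbhs p (ball p r%:C%C) by apply: nbhsx_ballx; rewrite ltcR.
have freq N : exists2 i, (N <= i)%N & rnorm (p - S (f i)) < r.
  have [] := pP ((S \o f) @` [set i | (N <= i)%N]) _ _ ballp.
    by exists N => // i /= Ni; exists i.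
  move=> _ [[i /= Ni <-] pi]; exists i => //.
  by move: pi; rewrite -ball_normE/= -rnormE ltcR.
have [i _ pi] := freq 0%N; have [j ij pj] := freq i.+1.
have mij : mu i != mu j by apply/eqP => /muI e; rewrite e ltnn in ij.
have o := eigenvector_orthogonal mij (ef i) (ef j).
have nS k : c <= rdot (S (f k)) (S (f k)).
  by rewrite rdot_adjoint ef rdotZr rdotxx f1 expr1n mulr1.
have r2 : r ^+ 2 = c / 2 by rewrite sqr_sqrtr// divr_ge0// ltW.
have sq x : 0 <= x -> x < r -> x ^+ 2 < c / 2.
  by move=> x0 xr; rewrite -r2 ltr_sqr ?nnegrE// ltW.
have := sq _ (rnorm_ge0 _) pi; have := sq _ (rnorm_ge0 _) pj.
(* Parallelogram law for [a = S (f i)], [b = S (f j)]: [|2p - a - b|^2 + |a - b|^2 = 2 (|p - a|^2 +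
   |p - b|^2) < 2 c], while [|a - b|^2 >= 2 c]. *)
have : 0 <= rdot (2%:C%C *: p - S (f i) - S (f j))
                 (2%:C%C *: p - S (f i) - S (f j)).
  by rewrite rdotxx sqr_ge0.
rewrite -!rdotxx !(rdotBl, rdotBr, rdotZl, rdotZr).
rewrite !(rdotC _ p) (rdotC (S (f j)) (S (f i))) o.
have := nS i; have := nS j; lra.
Qed.

End CompactOperator.

(** * The listed eigenvalues: positivity of the first one and convergence to zero *)

Section EigenvalueSequence.
Variables (R : realType) (H G : hilbertType R) (S : {linear H -> G}) (T : G -> H).
Hypotheses (S_compact : compact_operator S) (S_adjoint : is_adjoint S T).
Variable lam : nat -> R.
Hypothesis lamP : eigenvalue_sequence (T \o S) lam.

(** A nonzero eigenvector forces a positive dimension, so the equinumerous set of indices is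
    nonempty. *)
Lemma eigenvalue_listed (mu : R) h : 0 < mu -> h != 0 ->
  T (S h) = mu%:C%C *: h -> exists2 n, (0 < n)%N & lam n = mu.
Proof.
move=> mu0 h0 eh; have [_ _ /(_ mu mu0)[m [e [_ eE]] cm]] := lamP.
have : op_eigenspace (T \o S) mu%:C%C h by [].
rewrite eE => -[c hE]; case: m => [|m] in e eE cm c hE *.
  by rewrite hE big_ord0 eqxx in h0.
apply: contrapT => nex; move: cm.
rewrite (_ : [set n | _] = set0); last first.
  by apply/seteqP; split => // n [n0 nmu]; apply: nex; exists n.
by rewrite card_eq_sym card_eq0 => /eqP/seteqP[/(_ 0%N)/(_ isT)].
Qed.

(** The index [n] itself makes the dimension positive; the first basis vector is nonzero by
    independence. *)
Lemma listed_eigenvalue n : (0 < n)%N -> 0 < lam n ->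
  exists2 f, f != 0 & T (S f) = (lam n)%:C%C *: f.
Proof.
move=> n0 ln0; have [_ _ /(_ _ ln0)[m [e [ei eE]] cm]] := lamP.
case: m => [|m] in e ei eE cm *.
  move: cm; rewrite II0 card_eq0 => /eqP/seteqP[/(_ n) + _].
  by case; split.
have sumE : \sum_i (i == ord0)%:R *: e i = e ord0.
  rewrite (bigD1 ord0)//= scale1r big1 ?addr0// => i /negbTE ->.
  by rewrite scale0r.
exists (e ord0).
  apply/eqP => e0; have /eqP := ei _ (etrans sumE e0) ord0.
  by rewrite /= ?eqxx pnatr_eq0.
have : op_eigenspace (T \o S) (lam n)%:C%C (e ord0).
  by rewrite eE; exists (fun i => (i == ord0)%:R); rewrite sumE.
by [].
Qed.

Lemma eigenvalue1_gt0 : (exists f, S f <> 0) -> 0 < lam 1%N.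
Proof.
move=> /(compact_top_eigenvector S_compact S_adjoint)[mu mu0 [h h0 eh]].
have [n n0 nmu] := eigenvalue_listed mu0 h0 eh.
by have [_ + _] := lamP; move=> /(_ 1%N n isT n0); apply: lt_le_trans; rewrite nmu.
Qed.

(** Otherwise the sequence is constant from [n] on, against the finite multiplicity of [lam n]. *)
Lemma eigenvalue_decreases n : (0 < n)%N -> 0 < lam n ->
  exists2 m, (n < m)%N & lam m < lam n.
Proof.
move=> n0 ln0; have [_ mono /(_ _ ln0)[k _ ck]] := lamP.
apply: contrapT => nex; apply: infinite_nat.
have /(finite_preimage (f := addn n)) :
    finite_set [set m | (0 < m)%N /\ lam m = lam n].
  by apply/finite_setP; exists k.
rewrite (_ : _ @^-1` _ = setT); last first.
  apply/seteqP; split => // i _ /=; split; first by rewrite addn_gt0 n0.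
  apply/eqP; rewrite eq_le mono ?leq_addr//= leNgt.
  apply/negP => lt; apply: nex; exists (n + i)%N => //.
  rewrite -[ltnLHS]addn0 ltn_add2l lt0n; apply/eqP => i0.
  by rewrite i0 addn0 ltxx in lt.
by apply => i j _ _ /addnI.
Qed.

(** Otherwise iterating [eigenvalue_decreases] from index 1 yields infinitely many distinct
    eigenvalues above [e], which compactness excludes. *)
Lemma eigenvalue_small (e : R) : 0 < e -> exists2 n, (0 < n)%N & lam n <= e.
Proof.
move=> e0; apply: contrapT => nex.
have lame n : (0 < n)%N -> e < lam n.
  by move=> n0; rewrite ltNge; apply/negP => le; apply: nex; exists n.
have /choice[next nextP] n : exists m, (0 < n)%N -> (n < m)%N /\ lam m < lam n.
  have [n0|n0] := posnP n; first by exists 0%N; rewrite n0.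
  by have [m] := eigenvalue_decreases n0 (lt_trans e0 (lame _ n0)); exists m.
pose phi i := iter i next 1%N.
have phi0 i : (0 < phi i)%N.
  by elim: i => //= i IH; have [/(leq_trans _) -> //] := nextP _ IH.
have dec i j : (i < j)%N -> lam (phi j) < lam (phi i).
  elim: j => // j IH; rewrite ltnS leq_eqVlt => /predU1P[->|/IH].
    by have [] := nextP _ (phi0 j).
  by apply: lt_trans; have [] := nextP _ (phi0 j).
apply: (compact_eigenvalues_not_away0 S_compact S_adjoint (mu := lam \o phi) e0).
- by move=> i j /= eij; case: (ltngtP i j) => // /dec; rewrite eij ltxx.
- by move=> i; exact/ltW/lame.
- by move=> i; apply: listed_eigenvalue => //; exact/(lt_trans e0)/lame.
Qed.

End EigenvalueSequence.

(** * The information complexity as a true minimum *)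

Section InfoComplexity.
Variables (R : realType) (cri : criterion) (lam : nat -> R) (eps : R).
Hypothesis small : exists2 n, (0 < n)%N & lam n <= eps ^+ 2 * CRI cri lam.

(** The hypothesis [small] makes the set nonempty, so it has a least element and the default of
    [xget] is never returned. *)
Let info_complexityP :
  lam (info_complexity cri lam eps).+1 <= eps ^+ 2 * CRI cri lam /\
  forall m, lam m.+1 <= eps ^+ 2 * CRI cri lam ->
    (info_complexity cri lam eps <= m)%N.
Proof.
rewrite /info_complexity; case: xgetP => [n _ [? ?]//|none].
have ex : exists n, lam n.+1 <= eps ^+ 2 * CRI cri lam.
  by have [[//|n] _ len] := small; exists n.
case: (ex_minnP ex) => m lem minm.
by case: (none m).
Qed.

Lemma le_info_complexity :
  lam (info_complexity cri lam eps).+1 <= eps ^+ 2 * CRI cri lam.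
Proof. by case: info_complexityP. Qed.

Lemma lt_info_complexity : (0 < info_complexity cri lam eps)%N ->
  eps ^+ 2 * CRI cri lam < lam (info_complexity cri lam eps).
Proof.
have [_] := info_complexityP; case: (info_complexity cri lam eps) => // N minN _.
by rewrite ltNge; apply/negP => /minN; rewrite ltnn.
Qed.

End InfoComplexity.

(** * Estimates for logarithms and real powers *)

Lemma ln_near_infty (R : realType) (A : R) : \forall n \near \oo, A <= ln n%:R.
Proof.
near=> n; rewrite -ler_expR lnK; last first.
  by rewrite posrE ltr0n; near: n; exact: nbhs_infty_gt.
by near: n; exact: nbhs_infty_ger.
Unshelve. all: by end_near. Qed.

Lemma powR_le (R : realType) (r x y : R) :
  0 <= r -> 0 <= x -> x <= y -> x `^ r <= y `^ r.
Proof.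
by move=> r0 x0 xy; apply: ge0_ler_powR; rewrite ?nnegrE// (le_trans x0).
Qed.

(** [L <= delta * L^2] and [L^2 <= (L^k)^t <= x^t]. It is applied with [L = ln N] and [x] either [d]
    or [w eps]. *)
Lemma le_mul_powR_square (R : realType) (delta L x t : R) (k : nat) :
  0 < delta -> 1 <= L -> delta^-1 <= L -> 0 < t -> 2 <= k%:R * t ->
  L ^+ k <= x -> L <= delta * x `^ t.
Proof.
move=> d0 L1 dL t0 kt Lx; have L0 : 0 <= L by lra.
have h : L ^+ 2 <= x `^ t.
  rewrite -powR_mulrn// (le_trans (ler_powR L1 kt))// powRrM powR_mulrn//.
  by apply: powR_le; rewrite ?exprn_ge0// ltW.
by rewrite mulrC -ler_pdivrMr// (le_trans _ h)// expr2 ler_wpM2l.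
Qed.

(** * Uniform weak tractability for a general rate [w] as eigenvalue decay *)

Section UniformWeakTractability.
Variables (R : realType) (cri : criterion) (lam : nat -> nat -> R).
Hypothesis lam_mono : forall d m n, (0 < d)%N -> (0 < m)%N -> (m <= n)%N ->
  lam d n <= lam d m.
Hypothesis lam_small : forall d (e : R), (0 < d)%N -> 0 < e ->
  exists2 n, (0 < n)%N & lam d n <= e.
Hypothesis CRI_gt0 : forall d, (0 < d)%N -> 0 < CRI cri (lam d).

Variables (w E : R -> R).
Hypothesis w_ge1 : forall e : R, 0 < e -> 1 <= w e.
Hypothesis w_anti : forall a b : R, 0 < a -> a <= b -> w b <= w a.
Hypothesis E_gt0 : forall x, 1 <= x -> 0 < E x.
Hypothesis wE : forall x, 1 <= x -> w (E x) = x.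
Hypothesis E_inv : forall x, 1 <= x -> x <= (E x)^-1.

(** Common form of [ALG_WT] and [EXP_WT], to which it unfolds for the two choices of [w]. *)
Definition weak_tractability (s t : R) : Prop :=
  forall delta : R, 0 < delta -> exists K : R, forall (d : nat) (eps : R),
    (0 < d)%N -> 0 < eps -> K <= d%:R + eps^-1 ->
    ln (maxn 1 (info_complexity cri (lam d) eps))%:R
      / (d%:R `^ t + w eps `^ s) <= delta.

Definition eigenvalue_decay : Prop :=
  forall k B : nat, (0 < k)%N -> (0 < B)%N -> \forall n \near \oo,
    forall d, admissible R n k d ->
      lam d n <= E (ln n%:R ^+ B) ^+ 2 * CRI cri (lam d).

Let small d eps : (0 < d)%N -> 0 < eps ->
  exists2 n, (0 < n)%N & lam d n <= eps ^+ 2 * CRI cri (lam d).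
Proof.
by move=> d0 e0; apply: lam_small; rewrite ?mulr_gt0 ?exprn_gt0 ?CRI_gt0.
Qed.

Lemma powR_expr_inv (L : R) (k : nat) : 0 <= L -> (0 < k)%N ->
  (L ^+ k) `^ k%:R^-1 = L.
Proof.
move=> L0 k0; rewrite -powR_mulrn// -powRrM mulfV ?powRr1//.
by rewrite pnatr_eq0 -lt0n.
Qed.

Lemma decay_of_tractability :
  (forall s t : R, 0 < s -> 0 < t -> weak_tractability s t) -> eigenvalue_decay.
Proof.
move=> wt k B k0 B0.
(* With these exponents both terms of the denominator are at most [L = ln n], so the factor [1 / 4]
   gives [ln N <= L / 2 < L], that is [N < n]. *)
have [|||K KP] := wt B%:R^-1 k%:R^-1 _ _ (1 / 4).
- by rewrite invr_gt0 ltr0n.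
- by rewrite invr_gt0 ltr0n.
- by lra.
near=> n.
have L1 : 1 <= ln n%:R :> R by near: n; exact: ln_near_infty.
have KL : K <= ln n%:R by near: n; exact: ln_near_infty.
have n0 : (0 < n)%N by near: n; exact: nbhs_infty_gt.
move=> d [d0 dn]; set L : R := ln n%:R in L1 KL dn *; have L0 : 0 <= L by lra.
have LB1 : 1 <= L ^+ B by rewrite exprn_ege1.
have LLB : L <= L ^+ B by rewrite -[leLHS]expr1 ler_weXn2l.
have e0 := E_gt0 LB1.
set eps := E (L ^+ B) in e0 *.
have := KP d eps d0 e0.
have -> : K <= d%:R + eps^-1.
  have := E_inv LB1; rewrite -/eps; have : 0 <= d%:R :> R by []; lra.
move=> /(_ isT); rewrite wE// powR_expr_inv//.
have dL : d%:R `^ k%:R^-1 <= L.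
  rewrite -[leRHS](@powR_expr_inv _ k)//.
  by apply: powR_le; rewrite ?invr_ge0.
have p0 := powR_ge0 (d%:R : R) k%:R^-1.
rewrite ler_pdivrMr; last by lra.
set N := info_complexity _ _ _ => lnN.
have : ln (maxn 1 N)%:R < L by lra.
rewrite ltr_ln ?posrE ?ltr0n ?leq_max// ltr_nat.
move=> /(leq_ltn_trans (leq_maxr _ _)) Nn.
exact: le_trans (lam_mono d0 _ Nn) (le_info_complexity (small d0 e0)).
Unshelve. all: by end_near. Qed.

Lemma tractability_of_decay : eigenvalue_decay ->
  forall s t : R, 0 < s -> 0 < t -> weak_tractability s t.
Proof.
move=> decay s t s0 t0 delta delta0.
have expo (r : R) : 0 < r -> exists2 k, (0 < k)%N & 2 <= k%:R * r.
  move=> r0; exists (Num.truncn (2 / r)).+1 => //.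
  by rewrite -ler_pdivrMr// ltW// truncnS_gt.
have [k k0 kt] := expo _ t0; have [B B0 Bs] := expo _ s0.
have [N0 _ N0P] : \forall n \near \oo,
    [/\ 1 <= ln n%:R :> R, delta^-1 <= ln n%:R &
    forall d, admissible R n k d ->
      lam d n <= E (ln n%:R ^+ B) ^+ 2 * CRI cri (lam d)].
  near=> n; split; [| |by near: n; exact: decay];
    by near: n; exact: ln_near_infty.
(* A denominator of at least [C] settles all [N <= N0]; the maximum with 1 keeps [C^(1/s)] in the
   domain of [E]. *)
pose C : R := Num.max 1 (ln N0.+1%:R / delta).
have C1 : 1 <= C by rewrite le_max lexx.
have Cln : ln N0.+1%:R <= delta * C.
  by rewrite mulrC -ler_pdivrMr// le_max lexx orbT.
have powC (r : R) : 0 < r -> 1 <= C `^ r^-1.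
  by move=> r0; rewrite -[leLHS](powRr0 C) ler_powR// invr_ge0 ltW.
have powCK (r x : R) : 0 < r -> C `^ r^-1 <= x -> C <= x `^ r.
  move=> r0 Cx; rewrite -[C]powRr1 ?(le_trans _ C1)//.
  rewrite -(@mulVf _ r) ?gt_eqF// powRrM.
  by apply: powR_le; rewrite ?powR_ge0// ltW.
(* Beyond this threshold [d >= C^(1/t)] or [eps <= E (C^(1/s))], so [d^t >= C] or
   [(w eps)^s >= C]. *)
exists (C `^ t^-1 + (E (C `^ s^-1))^-1) => d eps d0 e0 Kle.
have w0 : 0 < w eps by exact: lt_le_trans (w_ge1 e0).
have pd := powR_ge0 (d%:R : R) t; have pw := powR_gt0 s w0.
rewrite ler_pdivrMr; last by lra.
set N := info_complexity _ _ _.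
have [NN0|N0N] := leqP N N0.
  have lnN : ln (maxn 1 N)%:R <= ln N0.+1%:R :> R.
    by rewrite ler_ln ?posrE ?ltr0n ?leq_max// ler_nat geq_max/= ltnW.
  apply: (le_trans lnN); apply: (le_trans Cln); rewrite ler_pM2l//.
  have [dC|dC] := leP (C `^ t^-1) d%:R.
    by have := powCK _ _ t0 dC; lra.
  have eE : eps <= E (C `^ s^-1).
    by rewrite -lef_pV2 ?posrE ?E_gt0 ?powC//; lra.
  have := w_anti e0 eE; rewrite wE ?powC// => /(powCK _ _ s0); lra.
have N1 : (0 < N)%N by exact: leq_ltn_trans N0N.
rewrite (maxn_idPr N1).
have [L1 dL decayN] := N0P N (ltnW N0N).
have [dk|kd] := leP (d%:R : R) (ln N%:R ^+ k).
  have lt := lt_le_trans (lt_info_complexity (small d0 e0) N1)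
    (decayN d (conj d0 dk)).
  have LB1 : 1 <= (ln N%:R : R) ^+ B by rewrite exprn_ege1.
  have eE : eps <= E (ln N%:R ^+ B).
    move: lt; rewrite ltr_pM2r ?CRI_gt0// ltr_sqr ?nnegrE; [exact: ltW|exact: ltW|].
    exact/ltW/E_gt0.
  have := w_anti e0 eE; rewrite wE// => Bw.
  have := le_mul_powR_square delta0 L1 dL s0 Bs Bw.
  by have := mulr_ge0 (ltW delta0) pd; lra.
have := le_mul_powR_square delta0 L1 dL t0 kt (ltW kd).
by have := mulr_gt0 delta0 pw; lra.
Unshelve. all: by end_near. Qed.

Lemma uniform_weak_tractabilityP :
  (forall s t : R, 0 < s -> 0 < t -> weak_tractability s t) <-> eigenvalue_decay.
Proof. by split; [exact: decay_of_tractability|exact: tractability_of_decay]. Qed.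

End UniformWeakTractability.

(** * Eigenvalue decay as the limit conditions of the theorem *)

Section LimitCriteria.
Variable R : realType.

(** For [lam n = 0] the ratio is [+oo] and both sides are true; otherwise exponentiate. *)
Lemma le_ln_ratio cri (lam : nat -> R) n y : 0 < CRI cri lam -> 0 <= lam n ->
  (y%:E <= ln_ratio cri lam n)%E = (lam n <= expR (- y) * CRI cri lam).
Proof.
move=> c0; rewrite le_eqVlt /ln_ratio => /predU1P[<-|l0].
  by rewrite inve0 gt0_muley ?lte_fin//= leey mulr_ge0 ?expR_ge0// ltW.
rewrite inver gt_eqF// -EFinM lne_EFin ?divr_gt0// lee_fin.
rewrite -[LHS]ler_expR lnK ?posrE ?divr_gt0// ler_pdivlMr//.
by rewrite expRN mulrC ler_pdivlMl ?expR_gt0// mulrC.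
Qed.

(** Since [y > 1], the cut-off at 1 cannot be what exceeds [y]. *)
Lemma le_lne_maxe (y : R) (z : \bar R) : 1 < y ->
  ((ln y)%:E <= lne (maxe 1 z))%E = (y%:E <= z)%E.
Proof.
move=> y1; have y0 : 0 < y by lra.
rewrite -lne_EFin// lee_lne; last 2 first.
- by rewrite in_itv/= lee_fin ltW// leey.
- by rewrite in_itv/= leey andbT le_max lee_fin ler01.
by rewrite le_max lee_fin (lt_geF y1).
Qed.

(** An infimum is at least [A] iff every member is; [ln n >= 2] makes [ln (ln n)] positive, so that
    it can be multiplied out. *)
Lemma cvg_inf_ratioP (F : nat -> nat -> \bar R) k :
  ereal_inf [set (F d n / (ln (ln n%:R))%:E)%E | d in admissible R n k]
    @[n --> \oo] --> +oo%E <->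
  forall A : R, \forall n \near \oo, forall d, admissible R n k d ->
    ((A * ln (ln n%:R))%:E <= F d n)%E.
Proof.
have div n (x : \bar R) (A : R) : 2 <= ln n%:R :> R ->
    (A%:E <= x / (ln (ln n%:R))%:E)%E = ((A * ln (ln n%:R))%:E <= x)%E.
  move=> n2; have lln0 : 0 < ln (ln n%:R) :> R by rewrite ln_gt0//; lra.
  by rewrite inver gt_eqF//=; exact: (lee_pdivlMr A%:E x lln0).
rewrite cvgeyPge; split => h A; near=> n.
- have n2 : 2 <= ln n%:R :> R by near: n; exact: ln_near_infty.
  have /ereal_infP hn : (A%:E <= ereal_inf [set (F d n / (ln (ln n%:R))%:E)%E
      | d in admissible R n k])%E by near: n; exact: h.
  by move=> d dn; rewrite -div//; apply: hn; exists d.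
- have n2 : 2 <= ln n%:R :> R by near: n; exact: ln_near_infty.
  have hn : forall d, admissible R n k d ->
    ((A * ln (ln n%:R))%:E <= F d n)%E by near: n; exact: h.
  by apply/ereal_infP => _ [d dn <-]; rewrite div//; exact: hn.
Unshelve. all: by end_near. Qed.

Variables (cri : criterion) (lam : nat -> nat -> R).
Hypothesis lam_ge0 : forall d n, (0 < d)%N -> (0 < n)%N -> 0 <= lam d n.
Hypothesis CRI_gt0 : forall d, (0 < d)%N -> 0 < CRI cri (lam d).

Lemma exists_nat_ge (A : R) : exists2 B : nat, (0 < B)%N & A <= B%:R.
Proof. by exists (Num.truncn A).+1 => //; rewrite ltW// truncnS_gt. Qed.

(** Decay with exponent [B] says exactly that the log ratio is at least [2 B ln (ln n)], and [B] is
    arbitrary. *)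
Lemma algebraic_decayP : eigenvalue_decay cri lam GRing.inv <->
  forall k, (0 < k)%N ->
    ereal_inf [set (ln_ratio cri (lam d) n / (ln (ln n%:R))%:E)%E
              | d in admissible R n k] @[n --> \oo] --> +oo%E.
Proof.
have E2 (L : R) B : 0 < L -> ((L ^+ B)^-1) ^+ 2 = expR (- ((2 * B%:R) * ln L)).
  move=> L0; rewrite expRN exprVn; congr (_^-1).
  by rewrite -exprM mulnC -natrM mulr_natl -lnXn// lnK// posrE exprn_gt0.
split => [decay k k0|lim k B k0 B0].
- apply/(cvg_inf_ratioP (fun d n => ln_ratio cri (lam d) n)) => A.
  have [B B0 AB] := exists_nat_ge A.
  near=> n.
  have n0 : (0 < n)%N by near: n; exact: nbhs_infty_gt.
  have L1 : 2 <= ln n%:R :> R by near: n; exact: ln_near_infty.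
  have hn : forall d, admissible R n k d ->
    lam d n <= (ln n%:R ^+ B)^-1 ^+ 2 * CRI cri (lam d) by near: n; exact: decay.
  move=> d [d0 dn]; have := hn d (conj d0 dn).
  rewrite E2; last by lra.
  rewrite -le_ln_ratio ?lam_ge0 ?CRI_gt0//; apply: le_trans.
  rewrite lee_fin ler_wpM2r ?ln_ge0//; first by lra.
  by have : 0 <= B%:R :> R by []; lra.
- have /(cvg_inf_ratioP (fun d n => ln_ratio cri (lam d) n)) h := lim k k0.
  near=> n.
  have n0 : (0 < n)%N by near: n; exact: nbhs_infty_gt.
  have L1 : 2 <= ln n%:R :> R by near: n; exact: ln_near_infty.
  have hn : forall d, admissible R n k d ->
    ((2 * B%:R * ln (ln n%:R))%:E <= ln_ratio cri (lam d) n)%E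
    by near: n; exact: h.
  move=> d [d0 dn]; have := hn d (conj d0 dn).
  by rewrite le_ln_ratio ?lam_ge0 ?CRI_gt0// E2//; lra.
Unshelve. all: by end_near. Qed.

(** Decay with exponent [B] says that the log ratio is at least [2 L^B - 2], where [L = ln n]. For
    [L >= 2] this lies between [L^B] and [L^(B+1)], whose logarithms are [B ln L] and
    [(B+1) ln L]. *)
Lemma exponential_decayP : eigenvalue_decay cri lam (fun x => expR (1 - x)) <->
  forall k, (0 < k)%N ->
    ereal_inf [set (lne (maxe 1 (ln_ratio cri (lam d) n)) / (ln (ln n%:R))%:E)%E
              | d in admissible R n k] @[n --> \oo] --> +oo%E.
Proof.
have E2 (x : R) : expR (1 - x) ^+ 2 = expR (- (2 * x - 2)).
  by rewrite -expRM_natl; congr expR; lra.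
have geL (L : R) B : 2 <= L -> (0 < B)%N -> 2 <= L ^+ B.
  move=> L2 B0; apply: (le_trans L2); rewrite -[leLHS]expr1 ler_weXn2l//; lra.
split => [decay k k0|lim k B k0 B0].
- apply/(cvg_inf_ratioP (fun d n => lne (maxe 1 (ln_ratio cri (lam d) n))%E)) => A.
  have [B B0 AB] := exists_nat_ge A.
  near=> n.
  have n0 : (0 < n)%N by near: n; exact: nbhs_infty_gt.
  have L2 : 2 <= ln n%:R :> R by near: n; exact: ln_near_infty.
  have hn : forall d, admissible R n k d ->
    lam d n <= expR (1 - ln n%:R ^+ B) ^+ 2 * CRI cri (lam d)
    by near: n; exact: decay.
  move=> d [d0 dn]; have := hn d (conj d0 dn).
  have LB := geL _ _ L2 B0.
  rewrite E2 -le_ln_ratio ?lam_ge0 ?CRI_gt0// => le.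
  apply: (@le_trans _ _ (ln (ln n%:R ^+ B))%:E).
    rewrite lee_fin lnXn; last by lra.
    by rewrite -[_ *+ B]mulr_natl ler_wpM2r// ln_ge0//; lra.
  rewrite le_lne_maxe; last by lra.
  by apply: le_trans le; rewrite lee_fin; lra.
- have /(cvg_inf_ratioP (fun d n => lne (maxe 1 (ln_ratio cri (lam d) n))%E)) h :=
    lim k k0.
  near=> n.
  have n0 : (0 < n)%N by near: n; exact: nbhs_infty_gt.
  have L2 : 2 <= ln n%:R :> R by near: n; exact: ln_near_infty.
  have hn : forall d, admissible R n k d ->
    ((B.+1%:R * ln (ln n%:R))%:E <= lne (maxe 1 (ln_ratio cri (lam d) n)))%E
    by near: n; exact: h.
  move=> d [d0 dn]; have := hn d (conj d0 dn).
  have LB := geL _ _ L2 B0.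
  have L0 : 0 < ln n%:R :> R by lra.
  have LS : 2 * ln n%:R ^+ B <= ln n%:R ^+ B.+1 :> R.
    by rewrite exprS ler_pM2r// exprn_gt0.
  rewrite mulr_natl -lnXn// le_lne_maxe; last by lra.
  rewrite E2 -le_ln_ratio ?lam_ge0 ?CRI_gt0//; apply: le_trans.
  by rewrite lee_fin; lra.
Unshelve. all: by end_near. Qed.

End LimitCriteria.

(** * Both equivalences, from the spectral facts and the two choices of rate *)

Theorem theorem4 (R : realType) (H G : nat -> hilbertType R)
    (S : forall d : nat, {linear H d -> G d})
    (Sadj : forall d : nat, G d -> H d)
    (lam : nat -> nat -> R) (cri : criterion)
    (S_compact : forall d : nat, (0 < d)%N -> compact_operator (S d))
    (S_adjoint : forall d : nat, (0 < d)%N -> is_adjoint (S d) (Sadj d))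
    (lam_eigen : forall d : nat, (0 < d)%N ->
       eigenvalue_sequence (Sadj d \o S d) (lam d))
    (S_neq0 : cri = NOR ->
       forall d : nat, (0 < d)%N -> exists f : H d, S d f <> 0) :
  (ALG_UWT cri lam <->
    forall k : nat, (0 < k)%N ->
      ereal_inf [set (ln_ratio cri (lam d) n / (ln (ln n%:R))%:E)%E
                | d in admissible R n k] @[n --> \oo] --> +oo%E)
  /\
  (EXP_UWT cri lam <->
    forall k : nat, (0 < k)%N ->
      ereal_inf [set (lne (maxe 1 (ln_ratio cri (lam d) n))
                      / (ln (ln n%:R))%:E)%E
                | d in admissible R n k] @[n --> \oo] --> +oo%E).
Proof.
have lam_ge0 d n : (0 < d)%N -> (0 < n)%N -> 0 <= lam d n.
  by move=> /lam_eigen[+ _ _] => /[apply].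
have lam_mono d m n : (0 < d)%N -> (0 < m)%N -> (m <= n)%N -> lam d n <= lam d m.
  by move=> /lam_eigen[_ + _] => /[apply]/[apply].
have lam_small d (e : R) : (0 < d)%N -> 0 < e ->
    exists2 n, (0 < n)%N & lam d n <= e.
  move=> d0.
  exact: (eigenvalue_small (S_compact d d0) (S_adjoint d d0) (lam_eigen d d0)).
have CRI_gt0 d : (0 < d)%N -> 0 < CRI cri (lam d).
  move=> d0; case: cri S_neq0 => //= /(_ erefl d d0).
  exact: (eigenvalue1_gt0 (S_compact d d0) (S_adjoint d d0) (lam_eigen d d0)).
have max1 (e : R) : 1 <= Num.max 1 e^-1 by rewrite le_max lexx.
have max1_anti (a b : R) : 0 < a -> a <= b -> Num.max 1 b^-1 <= Num.max 1 a^-1.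
  move=> a0 ab; rewrite ge_max le_max lexx/= le_max lef_pV2 ?posrE ?ab ?orbT//.
  exact: lt_le_trans ab.
split.
- apply: iff_trans (algebraic_decayP lam_ge0 CRI_gt0).
  apply: (uniform_weak_tractabilityP lam_mono lam_small CRI_gt0
    (w := fun e => Num.max 1 e^-1)) => //.
  + by move=> x x1; rewrite invr_gt0 (lt_le_trans _ x1).
  + by move=> x x1; rewrite invrK; apply/max_idPr.
  + by move=> x x1; rewrite invrK.
- apply: iff_trans (exponential_decayP lam_ge0 CRI_gt0).
  apply: (uniform_weak_tractabilityP lam_mono lam_small CRI_gt0
    (w := fun e => 1 + ln (Num.max 1 e^-1))).
  + by move=> e _; rewrite lerDl ln_ge0.
  + move=> a b a0 ab; rewrite lerD2l ler_ln ?max1_anti// posrE.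
      exact: lt_le_trans (max1 b).
    exact: lt_le_trans (max1 a).
  + by move=> x _; exact: expR_gt0.
  + move=> x x1; have /max_idPr -> : 1 <= (expR (1 - x))^-1.
      by rewrite -expRN opprB -[leLHS]expR0 ler_expR subr_ge0.
    by rewrite -expRN opprB expRK; lra.
  (* [exp (x - 1) >= x], the tangent bound at [x = 1]. *)
  + by move=> x _; rewrite -expRN opprB; have := expR_ge1Dx (x - 1); lra.
Qed.
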